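(* Let $d\le 2.3146$ be a constant such that \textsc{Odd Cycle Transversal} can be solved in time $O^*(d^{c})$, where $c$ is the allowed size of the transversal. Then $2$-\textsc{bMVA} can be solved in time $O^*(d^{\zeta_p})$, where $\zeta_p=k-p$.
   Context: Multidimensional Binary Vector Assignment (\textsc{bMVA}). An instance $\mathcal{I}[m,n,p,k]$ consists of integers $m,n,p,k$, and $m$ sets (multisets) $V^1,\dots,V^m$, where each $V^i=\{v^i_1,\dots,v^i_n\}$ consists of $n$ binary vectors $v^i_j\in\{0,1\}^p$. A stack is an $m$-tuple $s=(v^s_1,\dots,v^s_m)$ with $v^s_i\in V^i$ for all $i\in[m]$; its associated vector is $v_s=\bigwedge_{i\in[m]}v^s_i$ (component-wise AND). A solution is a set $S=\{s_1,\dots,s_n\}$ of $n$ pairwise disjoint stacks, i.e. each vector $v^i_j$ belongs to exactly one stack. The cost of a vector $v\in\{0,1\}^p$ is its number of zeros, $c(v)=p-\sum_{r=1}^p v[r]$, and $c(S)=\sum_{j=1}^n c(v_{s_j})$. The question is whether there is a solution $S$ with $c(S)\le k$. $2$-\textsc{bMVA} is the restriction of \textsc{bMVA} to instances with $n=2$. Standing convention: instances are reduced, i.e. for every component $r\in[p]$ there is some $(i,j)\in[m]\times[n]$ with $v^i_j[r]=0$ (components equal to 1 in all vectors have been removed), and $p\le k$ (in a reduced instance every solution costs at least $p$). Hence $\zeta_p\ge 0$. \textsc{Odd Cycle Transversal}: given a graph $G=(V,E)$ and an integer $c\in\mathbb{N}$, decide whether there is a partition $(X,S_1,S_2)$ of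 $V$ (parts may be empty) with $|X|\le c$ such that $S_1$ and $S_2$ are independent sets. (It is known that this can be done in time $O^*(2.3146^c)$.) $O^*(\cdot)$ hides factors polynomial in the size of the instance. *)

(* Defs.v *)
From mathcomp Require Import all_boot all_order all_algebra.
From mathcomp Require Import reals.
Set Implicit Arguments.
Unset Strict Implicit.
Unset Printing Implicit Defensive.

(** * Machine model

    Random access machine under the logarithmic cost criterion (Aho, Hopcroft,
    Ullman), with structured control flow.  A program uses finitely many
    registers and an unbounded random access memory, both holding natural
    numbers.  An instruction costs the total bit length of the numbers
    (including memory addresses) it operates on, so every instruction costs at
    least 1.  Passing between this model and the word RAM changes running times
    only by factors polynomial in the input size and in the logarithm of the
    running time, so O^*(d^c) bounds do not depend on the choice. *)

Inductive binop := Add | Sub | Mul | Div.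

Definition binop_eval (o : binop) : nat -> nat -> nat :=
  match o with Add => addn | Sub => subn | Mul => muln | Div => divn end.

Inductive cmd :=
  | Skip
  | Const (x a : nat)             (* x := a *)
  | Op (o : binop) (x y z : nat)  (* x := y o z *)
  | Read (x y : nat)              (* x := mem[y] *)
  | Write (x y : nat)             (* mem[x] := y *)
  | Seq (c1 c2 : cmd)
  | If (x : nat) (c1 c2 : cmd)    (* tests x <> 0 *)
  | While (x : nat) (c : cmd).    (* loops as long as x <> 0 *)

Record state := State { reg : nat -> nat; mem : nat -> nat }.

Definition upd (f : nat -> nat) (a v : nat) : nat -> nat :=
  fun b => if b == a then v else f b.

Definition set_reg (s : state) (x v : nat) := State (upd (reg s) x v) (mem s).
Definition set_mem (s : state) (a v : nat) := State (reg s) (upd (mem s) a v).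

(* Length of the binary notation of x; blen 0 = 1. *)
Definition blen (x : nat) : nat := (trunc_log 2 x).+1.

(* [exec c s t s']: started in s, the program c halts in s' after time t. *)
Inductive exec : cmd -> state -> nat -> state -> Prop :=
  | exec_skip s : exec Skip s 1 s
  | exec_const s x a : exec (Const x a) s (blen a) (set_reg s x a)
  | exec_op s o x y z :
      exec (Op o x y z) s (blen (reg s y) + blen (reg s z))
        (set_reg s x (binop_eval o (reg s y) (reg s z)))
  | exec_read s x y :
      exec (Read x y) s (blen (reg s y) + blen (mem s (reg s y)))
        (set_reg s x (mem s (reg s y)))
  | exec_write s x y :
      exec (Write x y) s (blen (reg s x) + blen (reg s y))
        (set_mem s (reg s x) (reg s y))
  | exec_seq s c1 c2 t1 s1 t2 s2 :
      exec c1 s t1 s1 -> exec c2 s1 t2 s2 ->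
      exec (Seq c1 c2) s (t1 + t2) s2
  | exec_if_true s x c1 c2 t s' :
      reg s x != 0 -> exec c1 s t s' ->
      exec (If x c1 c2) s (blen (reg s x) + t) s'
  | exec_if_false s x c1 c2 t s' :
      reg s x = 0 -> exec c2 s t s' ->
      exec (If x c1 c2) s (blen (reg s x) + t) s'
  | exec_while_true s x c t1 s1 t2 s2 :
      reg s x != 0 -> exec c s t1 s1 -> exec (While x c) s1 t2 s2 ->
      exec (While x c) s (blen (reg s x) + t1 + t2) s2
  | exec_while_false s x c :
      reg s x = 0 -> exec (While x c) s (blen (reg s x)) s.

(* The input word occupies memory cells 0, 1, ...; everything else is 0. *)
Definition init (w : seq nat) : state := State (fun=> 0) (nth 0 w).

Definition bitsize (w : seq nat) : nat := \sum_(x <- w) blen x.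

(** * Decision problems and O^* running times *)

Record problem := Problem {
  instance : Type;
  encode : instance -> seq nat;
  admissible : instance -> Prop;  (* promise on the input *)
  yes : instance -> Prop
}.

(* P can be solved in time O^*(d^(kappa I)): the hidden polynomial factor is
   C * |I|^e, where |I| is the bit length of the encoding of I.  The answer is
   read off register 0. *)
Definition solvable_in_Ostar (R : realType) (P : problem) (d : R)
    (kappa : instance P -> nat) : Prop :=
  exists (prog : cmd) (C e : nat), forall I : instance P, admissible I ->
    exists (t : nat) (s : state),
      [/\ exec prog (init (encode I)) t s,
          (reg s 0 != 0) <-> yes I
        & (t%:R <= (C * bitsize (encode I) ^ e)%:R * d ^+ kappa I)%R].

Arguments solvable_in_Ostar {R} P d kappa.

(** * Odd Cycle Transversal *)

Record graph := Graph {
  order : nat;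
  adj : rel 'I_order;
  adj_sym : symmetric adj;
  adj_irrefl : irreflexive adj
}.

Definition independent (G : graph) (S : {set 'I_(order G)}) : Prop :=
  forall u v, u \in S -> v \in S -> ~~ adj u v.

Record oct_instance := OCTInstance { oct_graph : graph; oct_size : nat }.

(* Row-major adjacency matrix. *)
Definition oct_encode (I : oct_instance) : seq nat :=
  let G := oct_graph I in
  [:: order G; oct_size I] ++
  [seq nat_of_bool (adj u v) | u <- enum 'I_(order G), v <- enum 'I_(order G)].

Definition oct_yes (I : oct_instance) : Prop :=
  exists X S1 S2 : {set 'I_(order (oct_graph I))},
    [/\ X :|: S1 :|: S2 = [set: 'I_(order (oct_graph I))],
        [/\ [disjoint X & S1], [disjoint X & S2] & [disjoint S1 & S2]],
        #|X| <= oct_size I,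
        independent S1
      & independent S2].

Definition OCT : problem := Problem oct_encode (fun=> True) oct_yes.

(** * Multidimensional Binary Vector Assignment *)

Definition bvec (p : nat) := {ffun 'I_p -> bool}.

Definition vcost p (v : bvec p) : nat := p - \sum_(r < p) v r.

(* [bvec_at I i j] is the vector v^i_j; the V^i are families (multisets). *)
Record bmva_instance := BMVAInstance {
  bm : nat; bn : nat; bp : nat; bk : nat;
  bvec_at : 'I_bm -> 'I_bn -> bvec bp
}.

Arguments bvec_at : clear implicits.

(* A stack picks, for each i, the index j of a vector v^i_j of V^i. *)
Definition stack (I : bmva_instance) := {ffun 'I_(bm I) -> 'I_(bn I)}.

Definition stack_vec (I : bmva_instance) (s : stack I) : bvec (bp I) :=
  [ffun r => [forall i, bvec_at I i (s i) r]].

(* n pairwise disjoint stacks. *)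
Definition is_solution (I : bmva_instance) (S : 'I_(bn I) -> stack I) : Prop :=
  forall a b, a != b -> forall i, S a i != S b i.

Definition solution_cost (I : bmva_instance) (S : 'I_(bn I) -> stack I) : nat :=
  \sum_(a < bn I) vcost (stack_vec (S a)).

Definition bmva_yes (I : bmva_instance) : Prop :=
  exists S : 'I_(bn I) -> stack I, is_solution S /\ solution_cost S <= bk I.

Definition reduced (I : bmva_instance) : Prop :=
  (forall r, exists i j, bvec_at I i j r = false) /\ bp I <= bk I.

Definition bmva_encode (I : bmva_instance) : seq nat :=
  [:: bm I; bn I; bp I; bk I] ++
  [seq nat_of_bool (bvec_at I ij.1 ij.2 r) |
     ij <- [seq (i, j) | i <- enum 'I_(bm I), j <- enum 'I_(bn I)],
     r <- enum 'I_(bp I)].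

Definition two_bMVA : problem :=
  Problem bmva_encode (fun I => bn I = 2 /\ reduced I) bmva_yes.

(* The truncated subtraction is harmless: bp I <= bk I on reduced instances. *)
Definition zeta_p (I : bmva_instance) : nat := bk I - bp I.

(* Main.v *)
Require Import Defs.
From mathcomp Require Import all_boot all_order all_algebra.
From mathcomp Require Import boolp reals.
From mathcomp Require Import zify.

(** For n = 2 every component costs 1 or 2, so a solution costs p plus the
    number of bad components, those with a zero in both stacks, and the
    question is whether some solution has at most zeta_p = k - p of them. The
    graph has a vertex for every component and p copies of every vector
    v^i_j; the copies of v^i_1 and v^i_2 form a complete bipartite graph,
    and component r is adjacent to the copies of v^i_j when v^i_j[r] = 0. A
    solution 2-colours the graph minus the bad components: a copy of a
    vector gets its stack, a good component the stack without a zero.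
    Conversely, if zeta_p >= p every solution will do, and otherwise a
    transversal of size zeta_p leaves a copy of every vector, whose colours
    define the stacks.

    A program builds this graph in time polynomial in the input and then
    runs the given program for odd cycle transversal. That run takes t >= 1
    steps, so the polynomial overhead is absorbed by a factor on t,
    whatever d is. *)

Set Implicit Arguments.
Unset Strict Implicit.
Unset Printing Implicit Defensive.

(** * Bit lengths of numbers and of the results of operations *)

Lemma blen_gt0 x : 0 < blen x. Proof. by []. Qed.

Lemma blen_le x n : x < 2 ^ n -> 0 < n -> blen x <= n.
Proof.
move=> lt_x n_gt0; case: x lt_x => [|x] lt_x.
  by rewrite /blen trunc_log0.
have := trunc_logP (isT : 1 < 2) (isT : 0 < x.+1).
by move=> /leq_ltn_trans/(_ lt_x); rewrite ltn_exp2l.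
Qed.

Lemma blen_lt x : x < 2 ^ blen x.
Proof. exact: trunc_log_ltn. Qed.

Lemma leq_blen x y : x <= y -> blen x <= blen y.
Proof. by move=> le_xy; rewrite blen_le // (leq_ltn_trans le_xy) ?blen_lt. Qed.

Lemma blen_leS x : blen x <= x.+1.
Proof. by rewrite blen_le // (ltn_trans (ltnSn x)) // ltn_expl. Qed.

Lemma blen_bool (b : bool) : blen b = 1.
Proof. by case: b. Qed.

(** For addition, both powers [2 ^ blen x] and [2 ^ blen y] are at least 2, so their sum is at most
    their product. *)
Lemma blen_binop o x y : blen (binop_eval o x y) <= blen x + blen y.
Proof.
have bx := blen_lt x; have by_ := blen_lt y.
have := leq_addr (blen y) (blen x) => le_x.
case: o => /=.
- apply: blen_le; last by rewrite addn_gt0.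
  rewrite expnD.
  have : 2 <= 2 ^ blen x by rewrite /blen expnS leq_pmulr ?expn_gt0.
  have : 2 <= 2 ^ blen y by rewrite /blen expnS leq_pmulr ?expn_gt0.
  move: (2 ^ blen x) (2 ^ blen y) bx by_ => a b; nia.
- exact: leq_trans (leq_blen (leq_subr _ _)) le_x.
- apply: blen_le; last by rewrite addn_gt0.
  by rewrite expnD ltn_mul.
- exact: leq_trans (leq_blen (leq_div _ _)) le_x.
Qed.

Lemma exec_gt0 c s t s' : exec c s t s' -> 0 < t.
Proof. by elim=> *; rewrite ?addn_gt0 ?blen_gt0 //; apply/orP; left. Qed.

Lemma updE f a v b : upd f a v b = if b == a then v else f b.
Proof. by []. Qed.

(** * Compiling expressions *)

Inductive expr :=
  | Lit (a : nat)
  | Var (x : nat)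
  | Bin (o : binop) (e1 e2 : expr)
  | Fetch (e : expr).

Fixpoint eval (s : state) (e : expr) : nat :=
  match e with
  | Lit a => a
  | Var x => reg s x
  | Bin o e1 e2 => binop_eval o (eval s e1) (eval s e2)
  | Fetch e => Defs.mem s (eval s e)
  end.

Fixpoint vars_below (k : nat) (e : expr) : bool :=
  match e with
  | Lit _ => true
  | Var x => x < k
  | Bin _ e1 e2 => vars_below k e1 && vars_below k e2
  | Fetch e => vars_below k e
  end.

(* The value ends up in register [k]; the registers above [k] are scratch space
   that is zero before and after, so that the final state is determined
   exactly. *)
Fixpoint code (k : nat) (e : expr) : cmd :=
  match e with
  | Lit a => Const k a
  | Var x => Seq (Const k 0) (Op Add k x k)
  | Bin o e1 e2 =>
      Seq (code k e1)
        (Seq (code k.+1 e2) (Seq (Op o k k k.+1) (Const k.+1 0)))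
  | Fetch e => Seq (code k e) (Read k k)
  end.

Definition zero_from (k : nat) (s : state) : Prop :=
  forall y, k <= y -> reg s y = 0.

Definition bounded (W : nat) (s : state) : Prop :=
  (forall y, blen (reg s y) <= W) /\ (forall a, blen (Defs.mem s a) <= W).

Lemma bounded_gt0 W s : bounded W s -> 0 < W.
Proof. by case=> /(_ 0) + _; apply: leq_trans. Qed.

Lemma bounded_mono V W s : V <= W -> bounded V s -> bounded W s.
Proof.
by move=> leVW [br bm]; split=> y; apply: leq_trans leVW;
  [apply: br | apply: bm].
Qed.

Lemma bounded_set_reg W s x v :
  bounded W s -> blen v <= W -> bounded W (set_reg s x v).
Proof. by move=> [br bm] bv; split=> //= y; rewrite updE; case: ifP. Qed.

Lemma bounded_set_mem W s a v :
  bounded W s -> blen v <= W -> bounded W (set_mem s a v).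
Proof. by move=> [br bm] bv; split=> //= y; rewrite updE; case: ifP. Qed.

Lemma eval_set_reg k e s v :
  vars_below k e -> eval (set_reg s k v) e = eval s e.
Proof.
elim: e => //= [x|o e1 IH1 e2 IH2|e IH].
- by rewrite updE; case: eqP => // ->; rewrite ltnn.
- by case/andP=> /IH1-> /IH2->.
- by move/IH->.
Qed.

Lemma vars_belowW k k' e : k <= k' -> vars_below k e -> vars_below k' e.
Proof.
move=> le_k; elim: e => //= [x|o e1 IH1 e2 IH2].
- by move/leq_trans; apply.
- by case/andP=> /IH1-> /IH2->.
Qed.

(** The factor depends on the expression alone. A fetch resets it to 1, since memory contents are
    bounded whatever the address. *)
Lemma eval_blen e : exists K, forall W s, bounded W s ->
  blen (eval s e) <= K * W.
Proof.
elim: e => [a|x|o e1 [K1 IH1] e2 [K2 IH2]|e [K IH]] /=.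
- by exists (blen a) => W s /bounded_gt0 W_gt0; rewrite leq_pmulr.
- by exists 1 => W s [br _]; rewrite mul1n.
- exists (K1 + K2) => W s bW; rewrite mulnDl.
  exact: leq_trans (blen_binop _ _ _) (leq_add (IH1 _ _ bW) (IH2 _ _ bW)).
- by exists 1 => W s [_ bm]; rewrite mul1n.
Qed.

Lemma state_eq s s' : reg s =1 reg s' -> Defs.mem s =1 Defs.mem s' -> s = s'.
Proof. by case: s s' => r m [r' m'] /= /funext-> /funext->. Qed.

Lemma code_exec e : exists K, forall k W s, vars_below k e ->
  zero_from k.+1 s -> bounded W s ->
  exists t, exec (code k e) s t (set_reg s k (eval s e)) /\ t <= K * W.
Proof.
elim: e => [a|x|o e1 [K1 IH1] e2 [K2 IH2]|e [K IH]] /=.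
- exists (blen a) => k W s _ _ /bounded_gt0 W_gt0; exists (blen a).
  by split; [apply: exec_const | rewrite leq_pmulr].
- exists 3 => k W s lt_xk _ bW; have W_gt0 := bounded_gt0 bW.
  exists (blen 0 + (blen (reg s x) + blen 0)); split; last first.
    by have [/(_ x) bx _] := bW; rewrite /blen trunc_log0 in bx *; lia.
  have neq_xk : (x == k) = false by rewrite ltn_eqF.
  apply: exec_seq; first exact: exec_const.
  set s1 := set_reg s k 0.
  have := exec_op s1 Add k x k; rewrite /= !updE eqxx neq_xk addn0 => ex.
  suff <- : set_reg s1 k (reg s x) = set_reg s k (reg s x) by [].
  by apply: state_eq => //= y; rewrite !updE; case: eqP.
- have [V1 bV1] := eval_blen e1; have [V2 bV2] := eval_blen e2.
  exists (K1 + K2 * V1.+1 + V1 + V2 + 1) => k W s /andP[vb1 vb2] z bW.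
  have W_gt0 := bounded_gt0 bW.
  have [t1 [ex1 le1]] := IH1 k W s vb1 z bW.
  set s1 := set_reg s k _ in ex1.
  (* Register [k] may now hold [V1 * W] bits, so the second operand is charged against a larger
     bound; the successor keeps that bound at least [W]. *)
  have bW1 : bounded (V1.+1 * W) s1.
    apply: bounded_set_reg; first by apply: bounded_mono bW; rewrite leq_pmull.
    by apply: leq_trans (bV1 _ _ bW) _; rewrite leq_mul2r leqnSn orbT.
  have z1 : zero_from k.+2 s1.
    by move=> y lt_y /=; rewrite updE gtn_eqF ?z // ltnW.
  have [t2 [ex2 le2]] := IH2 k.+1 _ s1 (vars_belowW (leqnSn k) vb2) z1 bW1.
  rewrite eval_set_reg // in ex2; set s2 := set_reg s1 k.+1 _ in ex2.
  have ex3 := exec_op s2 o k k k.+1.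
  have r1 : reg s2 k = eval s e1 by rewrite /= !updE eqxx ltn_eqF.
  have r2 : reg s2 k.+1 = eval s e2 by rewrite /= !updE eqxx.
  rewrite r1 r2 in ex3.
  have := exec_seq ex1 (exec_seq ex2 (exec_seq ex3 (exec_const _ k.+1 0))).
  set sf := set_reg (set_reg _ _ _) _ _.
  have -> : sf = set_reg s k (binop_eval o (eval s e1) (eval s e2)).
    apply: state_eq => //= y; rewrite /sf /s2 /s1 /= !updE.
    case: (y =P k.+1) => [->|_]; last by case: eqP.
    by rewrite gtn_eqF // z.
  move=> ex; eexists; split; first exact: ex.
  have := bV1 _ _ bW; have := bV2 _ _ bW; rewrite [blen 0](_ : _ = 1) //.
  rewrite !mulnDl mulnA in le2 *; lia.
- have [V bV] := eval_blen e.
  exists (K + V + 1) => k W s vb z bW.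
  have [t1 [ex1 le1]] := IH k W s vb z bW.
  have := exec_read (set_reg s k (eval s e)) k k; rewrite /= updE eqxx => ex2.
  exists (t1 + (blen (eval s e) + blen (Defs.mem s (eval s e)))); split.
    apply: exec_seq ex1 _.
    suff <- : set_reg (set_reg s k (eval s e)) k (Defs.mem s (eval s e))
              = set_reg s k (Defs.mem s (eval s e)) by [].
    by apply: state_eq => //= y; rewrite !updE; case: eqP.
  have [_ /(_ (eval s e)) bm] := bW; have := bV _ _ bW; rewrite !mulnDl; lia.
Qed.

(** * Straight-line programs *)

Inductive stmt := Assign (x : nat) (e : expr) | Store (e1 e2 : expr).

Definition denote (s : state) (c : stmt) : state :=
  match c with
  | Assign x e => set_reg s x (eval s e)
  | Store e1 e2 => set_mem s (eval s e1) (eval s e2)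
  end.

Definition stmt_below (k : nat) (c : stmt) : bool :=
  match c with
  | Assign x e => (x < k) && vars_below k e
  | Store e1 e2 => vars_below k e1 && vars_below k e2
  end.

(** In an assignment the addition merely copies register [k], because register [k.+1] is zero by
    then. *)
Definition stmt_code (k : nat) (c : stmt) : cmd :=
  match c with
  | Assign x e => Seq (code k e) (Seq (Op Add x k k.+1) (Const k 0))
  | Store e1 e2 =>
      Seq (code k e1) (Seq (code k.+1 e2)
        (Seq (Write k k.+1) (Seq (Const k 0) (Const k.+1 0))))
  end.

Definition block_code (k : nat) (b : seq stmt) : cmd :=
  foldr (fun c => Seq (stmt_code k c)) Skip b.

Lemma stmt_exec k c : stmt_below k c -> exists K, forall W s,
  zero_from k s -> bounded W s ->
  [/\ exists t, exec (stmt_code k c) s t (denote s c) /\ t <= K * W,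
      zero_from k (denote s c) & bounded (K * W) (denote s c)].
Proof.
case: c => [x e|e1 e2] /= /andP[].
- move=> lt_xk vb; have [K code_e] := code_exec e; have [V bV] := eval_blen e.
  exists (K + V + 3) => W s z bW; have W_gt0 := bounded_gt0 bW.
  have zS : zero_from k.+1 s by move=> y /ltnW/z.
  have [t1 [ex1 le1]] := code_e k W s vb zS bW.
  set s1 := set_reg s k _ in ex1.
  have ex2 := exec_op s1 Add x k k.+1.
  have r1 : reg s1 k = eval s e by rewrite /= updE eqxx.
  have r2 : reg s1 k.+1 = 0 by rewrite /= updE gtn_eqF // z.
  rewrite r1 r2 /= addn0 in ex2.
  have := exec_seq ex1 (exec_seq ex2 (exec_const _ k 0)).
  set sf := set_reg (set_reg _ _ _) _ _.
  have -> : sf = set_reg s x (eval s e).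
    apply: state_eq => //= y; rewrite /sf /s1 /= !updE.
    by case: (y =P k) => [->|//]; rewrite gtn_eqF // z.
  move=> ex; split.
  + eexists; split; first exact: ex.
    have := bV _ _ bW; rewrite [blen 0](_ : _ = 1) // !mulnDl; lia.
  + by move=> y le_ky /=; rewrite updE gtn_eqF ?z // (leq_trans lt_xk).
  + apply: bounded_set_reg; last first.
      by apply: leq_trans (bV _ _ bW) _; rewrite leq_mul2r; lia.
    by apply: bounded_mono bW; rewrite leq_pmull //; lia.
- move=> vb1 vb2.
  have [K1 code1] := code_exec e1; have [V1 bV1] := eval_blen e1.
  have [K2 code2] := code_exec e2; have [V2 bV2] := eval_blen e2.
  exists (K1 + K2 * V1.+1 + V1 + V2 + 2) => W s z bW.
  have W_gt0 := bounded_gt0 bW.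
  have zS : zero_from k.+1 s by move=> y /ltnW/z.
  have [t1 [ex1 le1]] := code1 k W s vb1 zS bW.
  set s1 := set_reg s k _ in ex1.
  have bW1 : bounded (V1.+1 * W) s1.
    apply: bounded_set_reg; first by apply: bounded_mono bW; rewrite leq_pmull.
    by apply: leq_trans (bV1 _ _ bW) _; rewrite leq_mul2r leqnSn orbT.
  have z1 : zero_from k.+2 s1.
    by move=> y lt_y /=; rewrite updE gtn_eqF ?zS // ltnW.
  have [t2 [ex2 le2]] := code2 k.+1 _ s1 (vars_belowW (leqnSn k) vb2) z1 bW1.
  rewrite eval_set_reg // in ex2; set s2 := set_reg s1 k.+1 _ in ex2.
  have ex3 := exec_write s2 k k.+1.
  have r1 : reg s2 k = eval s e1 by rewrite /= !updE eqxx ltn_eqF.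
  have r2 : reg s2 k.+1 = eval s e2 by rewrite /= !updE eqxx.
  rewrite r1 r2 in ex3.
  have := exec_seq ex1 (exec_seq ex2 (exec_seq ex3
            (exec_seq (exec_const _ k 0) (exec_const _ k.+1 0)))).
  set sf := set_reg (set_reg _ _ _) _ _.
  have -> : sf = set_mem s (eval s e1) (eval s e2).
    apply: state_eq => //= y; rewrite /sf /s2 /s1 /= !updE.
    case: (y =P k.+1) => [->|_]; first by rewrite z.
    by case: (y =P k) => [->|//]; rewrite z.
  move=> ex; split=> //.
  + eexists; split; first exact: ex.
    have := bV1 _ _ bW; have := bV2 _ _ bW; rewrite [blen 0](_ : _ = 1) //.
    rewrite !mulnDl mulnA in le2 *; lia.
  + apply: bounded_set_mem; last first.
      by apply: leq_trans (bV2 _ _ bW) _; rewrite leq_mul2r; lia.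
    by apply: bounded_mono bW; rewrite leq_pmull //; lia.
Qed.

(** Each statement may multiply the length bound by a constant, which is harmless for a fixed block.
    Repeating a block needs separate bounds on the intermediate states. *)
Lemma block_exec k b : all (stmt_below k) b -> exists K, forall W s,
  zero_from k s -> bounded W s ->
  exists t, exec (block_code k b) s t (foldl denote s b) /\ t <= K * W.
Proof.
elim: b => [|c b IH] /=.
  exists 1 => W s _ /bounded_gt0 W_gt0; exists 1; split; last by rewrite mul1n.
  exact: exec_skip.
case/andP=> /stmt_exec[K1 ex_c] /IH[K2 ex_b].
exists (K1 + K2 * K1) => W s z bW.
have [[t1 [ex1 le1]] z1 bW1] := ex_c W s z bW.
have [t2 [ex2 le2]] := ex_b _ _ z1 bW1.
exists (t1 + t2); split; first exact: exec_seq ex1 ex2.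
by rewrite mulnDl -mulnA leq_add.
Qed.

(** The states are indexed by the counter; [n + 1] tests and [n] runs of the body take at most [T]
    each. *)
Lemma countdown_exec x c T (st : nat -> state) n :
  (forall j, j <= n -> reg (st j) x = j) ->
  (forall j, j <= n -> blen j <= T) ->
  (forall j, j < n -> exists t, exec c (st j.+1) t (st j) /\ t <= T) ->
  exists t, exec (While x c) (st n) t (st 0) /\ t <= n.*2.+1 * T.
Proof.
elim: n => [|n IH] rx bx step.
  exists (blen (reg (st 0) x)); split; last by rewrite rx // mul1n bx.
  by apply: exec_while_false; rewrite rx.
have [t1 [ex1 le1]] := step n (ltnSn n).
have [||j lt_jn|t2 [ex2 le2]] := IH.
- by move=> j le_jn; apply: rx; apply: ltnW.
- by move=> j le_jn; apply: bx; apply: ltnW.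
- by apply: step; apply: ltnW.
exists (blen (reg (st n.+1) x) + t1 + t2); split.
  by apply: exec_while_true ex1 ex2; rewrite rx.
have := bx _ (leqnn n.+1); rewrite rx // doubleS; nia.
Qed.

(** * The graph *)

(** Serves both to locate vectors in the encoded instance and to recognize the adjacency matrix in
    the output. *)
Lemma nth_allpairs (S T : Type) (A : eqType) (x0 : S) (y0 : T) (z0 : A)
    (f : S -> T -> A) (s : seq S) (t : seq T) i j :
  i < size s -> j < size t ->
  nth z0 [seq f x y | x <- s, y <- t] (i * size t + j)
    = f (nth x0 s i) (nth y0 t j).
Proof.
move=> + lt_j; elim: s i => //= x s IH [_|i lt_i].
  by rewrite mul0n add0n nth_cat size_map lt_j (nth_map y0).
by rewrite nth_cat size_map mulSn -addnA ltnNge leq_addr /= addKn IH.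
Qed.

(* Vertices below [Q] form blocks of [p] copies: block [2 * i + j] belongs to
   the vector v^i_j, and vertex [Q + r] to the component [r].  The two blocks of
   a set V^i are completely joined, and [r] is joined to the block of v^i_j when
   v^i_j[r] = 0.  In the encoded instance [w] the vectors occupy the cells from
   4 on, in the order of their blocks. *)
Definition edge (p Q : nat) (w : seq nat) (lo hi : nat) : bool :=
  (lo < Q) &&
  (if hi < Q then (lo %/ p %/ 2 == hi %/ p %/ 2) && (lo %/ p != hi %/ p)
   else nth 0 w (4 + lo %/ p * p + (hi - Q)) == 0).

(** Sorting the ends makes the relation symmetric. Components are numbered after all copies, so in a
    mixed pair the component is [hi]. *)
Definition adjacent p Q w (u v : nat) : bool :=
  edge p Q w (minn u v) (maxn u v).

Lemma adjacentC p Q w u v : adjacent p Q w u v = adjacent p Q w v u.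
Proof. by rewrite /adjacent minnC maxnC. Qed.

Lemma adjacent_irrefl p Q w u : adjacent p Q w u u = false.
Proof.
by rewrite /adjacent minnn maxnn /edge; case: ltnP => //= _; rewrite !eqxx.
Qed.

Definition conflict_graph p Q w : graph :=
  @Graph (Q + p) (fun u v => adjacent p Q w u v)
    (fun u v => adjacentC p Q w u v) (fun u => adjacent_irrefl p Q w u).

Section Reduction.
Variables (m p k : nat) (f : 'I_m -> 'I_2 -> bvec p).
Hypothesis reduced_f : forall r, exists i j, f i j r = false.
Hypothesis le_pk : p <= k.

Let I := @BMVAInstance m 2 p k f.
Let w := bmva_encode I.
Let Q := 2 * m * p.
Let G := conflict_graph p Q w.

Lemma nth_encode (i : 'I_m) (j : 'I_2) (r : 'I_p) :
  nth 0 w (4 + (2 * i + j) * p + r) = f i j r.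
Proof.
set ps := [seq (i, j) | i <- enum 'I_m, j <- enum 'I_2].
have sz : size ps = m * 2 by rewrite size_allpairs !size_enum_ord.
have ltq : i * 2 + j < m * 2 by have := ltn_ord i; have := ltn_ord j; lia.
have := @nth_allpairs _ _ _ (i, j) r 0
  (fun ij r => nat_of_bool (f ij.1 ij.2 r)) ps (enum 'I_p) (i * 2 + j) r.
rewrite sz !size_enum_ord => /(_ ltq (ltn_ord r)).
rewrite nth_ord_enum -[2 as X in i * X](size_enum_ord 2).
rewrite (nth_allpairs i j) ?size_enum_ord // !nth_ord_enum /= => <-.
rewrite [2 * i]mulnC -addnA.
by [].
Qed.

Lemma size_encode : size w = 4 + Q.
Proof.
by rewrite /w /bmva_encode size_cat !size_allpairs !size_enum_ord /= /Q; lia.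
Qed.

Lemma blk_subproof (i : 'I_m) (j : 'I_2) (c : 'I_p) :
  (2 * i + j) * p + c < Q.
Proof.
have := ltn_ord i; have := ltn_ord j; have := ltn_ord c; rewrite /Q => lc lj li.
have : (2 * i + j).+1 * p <= 2 * m * p by rewrite leq_mul2r; lia.
by rewrite mulSn; lia.
Qed.

Definition blk i j c : 'I_(Q + p) := lshift p (Ordinal (blk_subproof i j c)).
Definition cmp (r : 'I_p) : 'I_(Q + p) := rshift Q r.

Lemma blk_lt i j c : blk i j c < Q.
Proof. exact: blk_subproof. Qed.

Lemma blk_div i j c : blk i j c %/ p = 2 * i + j.
Proof.
by have lt_c := ltn_ord c; rewrite /= divnMDl ?divn_small ?addn0 //; lia.
Qed.

Lemma blk_mod i j c : blk i j c %% p = c.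
Proof. by rewrite /= modnMDl modn_small. Qed.

Lemma block_half (i : 'I_m) (j : 'I_2) : (2 * i + j) %/ 2 = i.
Proof. by have := ltn_ord j; lia. Qed.

Lemma blk_inj i j c i' j' c' :
  blk i j c = blk i' j' c' -> i = i' /\ j = j'.
Proof.
move=> eq_b; have := blk_div i j c; rewrite eq_b blk_div => eq_ij.
have lj := ltn_ord j; have lj' := ltn_ord j'.
by split; apply: val_inj => /=; lia.
Qed.

Lemma blk_neq_cmp i j c r : blk i j c != cmp r.
Proof. by rewrite -val_eqE /= ltn_eqF // ltn_addr // (blk_lt i j c). Qed.

Lemma cmp_inj : injective cmp. Proof. exact: rshift_inj. Qed.

Variant vertex_spec : 'I_(Q + p) -> Prop :=
  | VertexBlk i j c : vertex_spec (blk i j c)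
  | VertexCmp r : vertex_spec (cmp r).

Lemma vertexP v : vertex_spec v.
Proof.
case: (split_ordP v) => [b|r] ->; last exact: VertexCmp.
have lt_b := ltn_ord b; have p_gt0 : 0 < p by rewrite /Q in b lt_b *; nia.
have lt_q : b %/ p < 2 * m by rewrite ltn_divLR.
have lt_i : b %/ p %/ 2 < m by lia.
have lt_j : (b %/ p) %% 2 < 2 by lia.
have lt_c : b %% p < p by rewrite ltn_mod.
suff -> : lshift p b = blk (Ordinal lt_i) (Ordinal lt_j) (Ordinal lt_c).
  exact: VertexBlk.
by apply: val_inj => /=; rewrite [2 * _]mulnC -divn_eq -divn_eq.
Qed.

Lemma adj_blk i j c i' j' c' :
  adj (g := G) (blk i j c) (blk i' j' c') = (i == i') && (j != j').
Proof.
have lj := ltn_ord j; have lj' := ltn_ord j'.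
rewrite /= /adjacent; have [le_b|lt_b] := leqP (blk i j c) (blk i' j' c');
  rewrite /edge !blk_lt !blk_div !block_half /= -!(inj_eq val_inj) /=; lia.
Qed.

Lemma adj_blk_cmp i j c r : adj (g := G) (blk i j c) (cmp r) = ~~ f i j r.
Proof.
have lt_bQ := blk_lt i j c.
have lt_b : blk i j c < cmp r by rewrite ltn_addr.
rewrite [adj _ _]/(adjacent p Q w (blk i j c) (cmp r)) /adjacent.
rewrite (minn_idPl _) ?(maxn_idPr _) 1?ltnW //.
rewrite /edge lt_bQ [val (cmp r)]/(Q + r) ifF; last by rewrite ltnNge leq_addr.
by rewrite addKn blk_div nth_encode eqb0.
Qed.

Lemma adj_cmp r r' : adj (g := G) (cmp r) (cmp r') = false.
Proof. by rewrite /= /adjacent /edge ltnNge leq_min !leq_addr. Qed.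

(** * Solutions, bad components and transversals *)

Definition zero_in (S : 'I_2 -> stack I) (a : 'I_2) (r : 'I_p) : bool :=
  [exists i, ~~ f i (S a i) r].

Definition bad S r : bool := [forall a, zero_in S a r].

Lemma ord2_cases (a : 'I_2) : a = ord0 \/ a = ord_max.
Proof.
by case: a => [[|[|//]] ?]; [left | right]; apply: val_inj.
Qed.

Lemma solution_onto (S : 'I_2 -> stack I) i j :
  @is_solution I S -> exists a, S a i = j.
Proof.
move=> solS; have := solS ord0 ord_max isT i; rewrite /=.
case: (ord2_cases (S ord0 i)) => e0; case: (ord2_cases (S ord_max i)) => e1;
  case: (ord2_cases j) => ->; rewrite e0 e1 //.
- by exists ord0.
- by exists ord_max.
- by exists ord_max.
- by exists ord0.
Qed.

Lemma bad_zero_in S r : bad S r = zero_in S ord0 r && zero_in S ord_max r.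
Proof.
apply/forallP/andP=> [z|[z0 z1] a]; first by rewrite !z.
by case: (ord2_cases a) => ->.
Qed.

(** Reducedness provides a vector with a zero at [r], and one of the two stacks contains it. *)
Lemma zero_in_some (S : 'I_2 -> stack I) r : @is_solution I S ->
  zero_in S ord0 r || zero_in S ord_max r.
Proof.
move=> solS; have [i [j fr]] := reduced_f r.
have [a Sa] := solution_onto i j solS.
have : zero_in S a r by apply/existsP; exists i; rewrite Sa fr.
by case: (ord2_cases a) => -> ->; rewrite ?orbT.
Qed.

(** Exchanging the sums, a component is counted once per stack with a zero there: at least once by
    [zero_in_some], and twice exactly when it is bad. *)
Lemma cost_bad (S : 'I_2 -> stack I) : @is_solution I S ->
  @solution_cost I S = p + #|[set r | bad S r]|.
Proof.
move=> solS.
have vcE a : vcost (stack_vec (S a)) = \sum_(r < p) zero_in S a r.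
  have : \sum_(r < p) zero_in S a r + \sum_(r < p) stack_vec (S a) r = p.
    rewrite -big_split /= -[RHS]card_ord -sum1_card; apply: eq_bigr => r _.
    by rewrite ffunE /zero_in -negb_forall; case: [forall _, _].
  by rewrite /vcost /= => eq_p; rewrite -{1}eq_p addnK.
rewrite /solution_cost; under eq_bigr do rewrite vcE.
have -> : p + #|[set r | bad S r]| = \sum_(r < p) (1 + bad S r).
  rewrite big_split sum1_card card_ord -sum1_card [X in _ + X = _]big_mkcond /=.
  by congr (_ + _); apply: eq_bigr => r _; rewrite inE; case: bad.
rewrite exchange_big; apply: eq_bigr => r _ /=.
rewrite bad_zero_in big_ord_recl big_ord1.
have -> : lift ord0 ord0 = ord_max :> 'I_2 by apply: val_inj.
have := zero_in_some r solS.
by case: (zero_in S ord0 r); case: (zero_in S ord_max r).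
Qed.

Lemma oct_of_bmva :
  bmva_yes I -> oct_yes (OCTInstance G (k - p)).
Proof.
case=> S [solS]; rewrite cost_bad //= => cost_le.
pose cls a : {set 'I_(Q + p)} :=
  [set v | [exists i, exists c, v == blk i (S a i) c]
           || [exists r, (v == cmp r) && ~~ zero_in S a r]].
have in_blk a i j c : (blk i j c \in cls a) = (S a i == j).
  rewrite inE.
  apply/orP/eqP=> [[/existsP[? /existsP[? /eqP/blk_inj[-> ->]]]|]|<-] //.
    by case/existsP=> r /andP[]; rewrite (negPf (blk_neq_cmp _ _ _ _)).
  by left; apply/existsP; exists i; apply/existsP; exists c.
have in_cmp a r : (cmp r \in cls a) = ~~ zero_in S a r.
  rewrite inE; apply/orP/idP=> [[/existsP[i' /existsP[c' ]]|]|z].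
  - by rewrite eq_sym (negPf (blk_neq_cmp _ _ _ _)).
  - by case/existsP=> r' /andP[/eqP/cmp_inj->].
  - by right; apply/existsP; exists r; rewrite eqxx.
pose X := cmp @: [set r | bad S r].
have blkNX i j c : blk i j c \notin X.
  by apply/imsetP=> -[r _ /eqP]; rewrite (negPf (blk_neq_cmp _ _ _ _)).
have cmpX r : (cmp r \in X) = bad S r.
  by rewrite mem_imset ?inE //; apply: cmp_inj.
(* A stack uses one vector of each [V^i], so no two of its copies are joined; an edge from a copy to
   a component would be a zero of the stack there. *)
have ind a : independent (G := G) (cls a).
  move=> u v.
  case: (vertexP u) => [i j c|r]; case: (vertexP v) => [i' j' c'|r'].
  - rewrite !in_blk adj_blk => /eqP <- /eqP <-.
    by case: eqP => //= ->; rewrite eqxx.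
  - rewrite in_blk in_cmp adj_blk_cmp => /eqP <-.
    by apply: contra => z; apply/existsP; exists i.
  - rewrite in_blk in_cmp adj_sym adj_blk_cmp => + /eqP <-.
    by apply: contra => z; apply/existsP; exists i'.
  - by rewrite adj_cmp.
exists X, (cls ord0), (cls ord_max); split=> //.
- apply/setP=> v; rewrite !in_setU in_setT; case: (vertexP v) => [i j c|r].
    rewrite !in_blk; have [a <-] := solution_onto i j solS.
    by case: (ord2_cases a) => ->; rewrite eqxx ?orbT.
  by rewrite cmpX !in_cmp bad_zero_in; do 2!case: zero_in.
- split; apply/pred0P=> v; rewrite /=; apply/negbTE;
    case: (vertexP v) => [i j c|r];
    rewrite ?(negPf (blkNX _ _ _)) ?in_blk ?cmpX ?in_cmp ?bad_zero_in //.
  + by rewrite andbAC andbN.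
  + by rewrite -andbA andbN andbF.
  + apply/andP=> -[/eqP<- /eqP e].
    by have := solS ord0 ord_max isT i; rewrite e eqxx.
  (* A component in both classes would have a zero in neither stack. *)
  + by rewrite -negb_or negbK; apply: zero_in_some.
- by rewrite card_imset /= ?leq_subRL //; apply: cmp_inj.
Qed.

Lemma bmva_of_oct :
  oct_yes (OCTInstance G (k - p)) -> bmva_yes I.
Proof.
case=> /= X [S1 [S2 [cover _ X_le ind1 ind2]]].
have cov v : v \notin X -> (v \in S1) || (v \in S2).
  by move/setP/(_ v): cover; rewrite !inE; case: (v \in X).
have [small|large] := leqP p (k - p).
  exists (fun a => [ffun=> a]); split.
    by move=> a b neq_ab i; rewrite !ffunE.
  rewrite cost_bad => [|a b neq_ab i]; last by rewrite !ffunE.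
  rewrite (leq_trans (leq_add (leqnn p) (max_card _))) //.
  by rewrite card_ord -leq_subRL.
have alive i j : exists c, blk i j c \notin X.
  apply/existsP; rewrite -negb_forall; apply/negP=> /forallP inX.
  have blk_injc : injective (blk i j).
    move=> c c' eq_c; apply: val_inj.
    by rewrite /= -(blk_mod i j c) eq_c blk_mod.
  have : blk i j @: [set: 'I_p] \subset X.
    by apply/subsetP=> _ /imsetP[c _ ->]; apply: inX.
  move/subset_leq_card; rewrite card_imset // cardsT card_ord.
  by rewrite leqNgt (leq_ltn_trans X_le).
pose has1 i j := [exists c, blk i j c \in S1].
have has2 i j : ~~ has1 i j -> exists c, blk i j c \in S2.
  have [c /cov] := alive i j; case/orP=> [c1|c2 _]; last by exists c.
  by case/existsP; exists c.
pose S (a : 'I_2) : stack I :=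
  [ffun i => if has1 i ord0 then a else rev_ord a].
(* If no copy of the first vector lies in [S1], one lies in [S2]; a surviving copy of the second
   vector is adjacent to it and so lies in [S1]. The swap by [rev_ord] puts that second vector into
   stack [ord0]. *)
have hasS1 i : exists c, blk i (S ord0 i) c \in S1.
  rewrite ffunE; case: ifPn => [/existsP//|/has2[c c2]].
  have [c' /cov/orP[c1|c2']] := alive i (rev_ord ord0); first by exists c'.
  by have := ind2 _ _ c2 c2'; rewrite adj_blk eqxx.
have hasS2 i : exists c, blk i (S ord_max i) c \in S2.
  rewrite ffunE; case: ifPn => [/existsP[c c1]|/has2].
    have [c' /cov/orP[c1'|c2]] := alive i ord_max; last by exists c'.
    by have := ind1 _ _ c1 c1'; rewrite adj_blk eqxx.
  by have -> : ord0 = rev_ord ord_max :> 'I_2 by apply: val_inj.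
have solS : @is_solution I S.
  move=> a b neq_ab i; rewrite !ffunE; case: ifP => // _.
  by rewrite (inj_eq rev_ord_inj).
exists S; split=> //; rewrite cost_bad //=.
(* A bad component outside [X] has a colour, and the stack of that colour has a vector with a zero
   there; a copy of this vector with the same colour is adjacent to the component. *)
suff : cmp @: [set r | bad S r] \subset X.
  move/subset_leq_card; rewrite card_imset => [le_X|]; last exact: cmp_inj.
  by rewrite -leq_subRL //; apply: leq_trans le_X X_le.
apply/subsetP=> _ /imsetP[r + ->]; rewrite inE bad_zero_in => /andP[].
case/existsP=> i0 z0 /existsP[i1 z1].
apply/negPn/negP=> /cov/orP[r1|r2].
- have [c c1] := hasS1 i0; have := ind1 _ _ c1 r1.
  by rewrite adj_blk_cmp z0.
- have [c c2] := hasS2 i1; have := ind2 _ _ c2 r2.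
  by rewrite adj_blk_cmp z1.
Qed.

End Reduction.

(** * The reduction program *)

(** Truncated subtraction yields minimum, maximum and comparisons without branching, with truth
    values 0 and 1. *)
Definition min_expr e1 e2 := Bin Defs.Sub e1 (Bin Defs.Sub e1 e2).
Definition max_expr e1 e2 := Bin Add e1 (Bin Defs.Sub e2 e1).
Definition not_expr e := Bin Defs.Sub (Lit 1) e.
Definition lt_expr e1 e2 := not_expr (not_expr (Bin Defs.Sub e2 e1)).
Definition eq_expr e1 e2 :=
  not_expr (Bin Add (Bin Defs.Sub e1 e2) (Bin Defs.Sub e2 e1)).

Lemma eval_not s e : eval s (not_expr e) = (eval s e == 0).
Proof. by rewrite /=; case: (eval s e). Qed.

Lemma eval_lt s e1 e2 : eval s (lt_expr e1 e2) = (eval s e1 < eval s e2).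
Proof. by rewrite /lt_expr !eval_not eqb0 subn_eq0 -ltnNge. Qed.

Lemma eval_eq s e1 e2 : eval s (eq_expr e1 e2) = (eval s e1 == eval s e2).
Proof. by rewrite eval_not /= addn_eq0 !subn_eq0 eqn_leq. Qed.

(* Register 0 holds the number [x] of matrix entries still to be computed, and
   registers 1 to 4 hold [p], [Q], the order of the graph and the size of the
   transversal. *)
Definition pos_expr := Bin Defs.Sub (Var 0) (Lit 1).
Definition row_expr := Bin Div pos_expr (Var 3).
Definition col_expr := Bin Defs.Sub pos_expr (Bin Mul row_expr (Var 3)).
Definition lo_expr := min_expr row_expr col_expr.
Definition hi_expr := max_expr row_expr col_expr.
Definition block_expr e := Bin Div e (Var 1).

(** This is [edge] without branching: products are conjunctions, and the two cases exclude each
    other, so their sum stays a truth value. The fetch always takes place, but is multiplied by zero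
    where it is irrelevant. *)
Definition entry_expr : expr :=
  Bin Mul (lt_expr lo_expr (Var 2))
    (Bin Add
      (Bin Mul (lt_expr hi_expr (Var 2))
        (Bin Mul
          (eq_expr (Bin Div (block_expr lo_expr) (Lit 2))
                   (Bin Div (block_expr hi_expr) (Lit 2)))
          (not_expr (eq_expr (block_expr lo_expr) (block_expr hi_expr)))))
      (Bin Mul (not_expr (lt_expr hi_expr (Var 2)))
        (not_expr (Fetch
          (Bin Add (Bin Add (Lit 4) (Bin Mul (block_expr lo_expr) (Var 1)))
                   (Bin Defs.Sub hi_expr (Var 2))))))).

(** Cell 3 is cleared once [k - p] is saved: for [p = 0] the output has only two cells, and all
    later ones must be zero. *)
Definition prelude : seq stmt :=
  [:: Assign 1 (Fetch (Lit 2));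
      Assign 2 (Bin Mul (Bin Mul (Lit 2) (Fetch (Lit 0))) (Var 1));
      Assign 3 (Bin Add (Var 2) (Var 1));
      Assign 4 (Bin Defs.Sub (Fetch (Lit 3)) (Var 1));
      Store (Lit 3) (Lit 0);
      Assign 0 (Bin Mul (Var 3) (Var 3))].

Definition body : seq stmt :=
  [:: Store (Bin Add (Var 0) (Lit 1)) entry_expr; Assign 0 pos_expr].

(** Clearing the registers makes the final state literally an [init] state, from which the given
    program can start. *)
Definition postlude : seq stmt :=
  [:: Store (Lit 0) (Var 3); Store (Lit 1) (Var 4);
      Assign 1 (Lit 0); Assign 2 (Lit 0); Assign 3 (Lit 0); Assign 4 (Lit 0)].

Definition reduction : cmd :=
  Seq (block_code 5 prelude)
    (Seq (While 0 (block_code 5 body)) (block_code 5 postlude)).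

(** * Correctness of the reduction program *)

Section Reduction_program.
Variables (w : seq nat) (p Q z : nat).
Let N := Q + p.

Definition entry_at (t : nat) : bool := adjacent p Q w (t %/ N) (t %% N).

(* The matrix is filled in from the last entry down, which overwrites the input
   only where it has already been consumed. *)
Definition loop_mem (x a : nat) : nat :=
  if 2 + x <= a < 2 + N * N then nat_of_bool (entry_at (a - 2))
  else if a == 3 then 0 else nth 0 w a.

Definition loop_state (x : nat) : state :=
  State (nth 0 [:: x; p; Q; N; z]) (loop_mem x).

Lemma loop_state_zero x : zero_from 5 (loop_state x).
Proof. by move=> y le_y /=; rewrite nth_default. Qed.

Lemma eval_entry x : Q != 1 -> x < N * N ->
  eval (loop_state x.+1) entry_expr = entry_at x.
Proof.
move=> Q_neq1 lt_x.
have N_gt0 : 0 < N by case: N lt_x.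
set s := loop_state x.+1.
have pos : eval s pos_expr = x by rewrite /= subn1.
have row : eval s row_expr = x %/ N by rewrite -[in RHS]pos.
have col : eval s col_expr = x %% N.
  rewrite [LHS](_ : _ = eval s pos_expr - eval s row_expr * N) // pos row.
  by rewrite {1}(divn_eq x N) addKn.
have lo : eval s lo_expr = minn (x %/ N) (x %% N) by rewrite minnE -row -col.
have hi : eval s hi_expr = maxn (x %/ N) (x %% N) by rewrite maxnE -row -col.
have bin o e1 e2 : eval s (Bin o e1 e2) = binop_eval o (eval s e1) (eval s e2).
  by [].
have ld e : eval s (Fetch e) = loop_mem x.+1 (eval s e) by [].
have r1 : eval s (Var 1) = p by [].
have r2 : eval s (Var 2) = Q by [].
have n a : eval s (Lit a) = a by [].
rewrite /entry_expr /block_expr.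
rewrite !(bin, eval_lt, eval_eq, eval_not, ld, lo, hi, r1, r2, n) /=.
rewrite /entry_at /adjacent /edge.
have lt_u : x %/ N < N by rewrite ltn_divLR.
have lt_v : x %% N < N by rewrite ltn_mod.
(* Putting the smaller index first can only lower the row-major position. *)
have le_addr : minn (x %/ N) (x %% N) * N + maxn (x %/ N) (x %% N) <= x.
  rewrite {5}(divn_eq x N).
  by move: (x %/ N) (x %% N) lt_u lt_v => u v lt_u lt_v; nia.
have lt_hi : maxn (x %/ N) (x %% N) < N by rewrite gtn_max lt_u.
move: (minn _ _) (maxn _ _) le_addr lt_hi => l h le_addr lt_h.
case: ltnP => //= lt_l; rewrite mul1n.
case: ltnP => [lt_hQ|le_Qh]; rewrite /= ?mul1n ?mul0n ?addn0.
  by rewrite !eqb0; do 2!case: eqP.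
(* The cell read has address at most [4 + l + (h - Q)], hence at most [x + 2] as [Q] is at least 2,
   while only cells from [x + 3] on are overwritten so far. *)
rewrite add0n /loop_mem ifF; last first.
  apply/negbTE; rewrite negb_and -ltnNge; apply/orP; left.
  have : l %/ p * p <= l by apply: leq_trunc_div.
  by rewrite /N in le_addr lt_h; nia.
by [].
Qed.

Lemma body_step x : Q != 1 -> x < N * N ->
  foldl denote (loop_state x.+1) body = loop_state x.
Proof.
move=> Q_neq1 lt_x; rewrite /body /foldl /denote eval_entry //.
apply: state_eq => [y|a] /=.
  by rewrite updE; case: y => [|y] //=; rewrite subn1.
rewrite updE addn1 /loop_mem; case: (a =P x.+2) => [->|neq_a].
  by rewrite !addSn add0n leqnn !ltnS lt_x /= subn2.
by rewrite !addSn !add0n ltn_neqAle eq_sym; case: eqP => //.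
Qed.

(** No input may survive beyond the output. For [p > 0] the [N * N + 2] output cells cover the
    input; for [p = 0] only cells 2 and 3 are left over, and both are zero. *)
Lemma postlude_state : Q + 4 = size w -> (p = 0 -> nth 0 w 2 = 0 /\ Q = 0) ->
  (0 < p -> Q.+2 <= N * N) ->
  foldl denote (loop_state 0) postlude
    = init (oct_encode (OCTInstance (conflict_graph p Q w) z)).
Proof.
move=> szw p0 p_gt0; apply: state_eq => [y|a] /=.
  by rewrite /upd; case: y => [|[|[|[|[|y]]]]] //=; rewrite nth_nil.
rewrite !updE; case: a => [|[|a]] //.
rewrite /= /loop_mem addn0 !ltnS subn2 /=.
case: ltnP => [lt_a|le_a].
  have N_gt0 : 0 < N by case: N lt_a.
  have lt_u : a %/ N < N by rewrite ltn_divLR.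
  have lt_v : a %% N < N by rewrite ltn_mod.
  have := @nth_allpairs _ _ _ (Ordinal lt_u) (Ordinal lt_u) 0
   (fun u v => nat_of_bool (adj (g := conflict_graph p Q w) u v)) (enum 'I_N)
   (enum 'I_N) (a %/ N) (a %% N).
  rewrite !size_enum_ord -divn_eq => -> //.
  rewrite -[a %/ N]/(val (Ordinal lt_u)).
  by rewrite -[a %% N]/(val (Ordinal lt_v)) !nth_ord_enum.
rewrite [RHS]nth_default; last by rewrite size_allpairs !size_enum_ord.
case: eqP => // neq_a.
have [p_eq0|p_pos] := posnP p; last first.
  by rewrite nth_default // -szw; have := p_gt0 p_pos; lia.
have [w2 Q0] := p0 p_eq0.
by case: a le_a neq_a => [|[|a]] // le_a _; rewrite nth_default // -szw Q0.
Qed.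

End Reduction_program.

Lemma prelude_state w : let p := nth 0 w 2 in let Q := 2 * nth 0 w 0 * p in
  foldl denote (init w) prelude
    = loop_state w p Q (nth 0 w 3 - p) ((Q + p) * (Q + p)).
Proof.
move=> p Q; apply: state_eq => [y|a] /=.
  by rewrite /upd /=; case: y => [|[|[|[|[|y]]]]] //=; rewrite nth_nil.
by rewrite updE /loop_mem leqNgt; case: ltnP.
Qed.

(** The successor pays for the default 0, which has length 1 even if [w] is empty. *)
Lemma blen_nth w a : blen (nth 0 w a) <= (bitsize w).+1.
Proof.
rewrite /bitsize; elim: w a => [|x w IH] a; first by rewrite nth_nil.
rewrite big_cons; case: a => [|a] /=; first by rewrite leqW // leq_addr.
by rewrite (leq_trans (IH a)) // ltnS leq_addl.
Qed.

Lemma size_bitsize w : size w <= bitsize w.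
Proof. by rewrite -sum1_size; apply: leq_sum. Qed.

Lemma reduction_exec : exists K, forall (w : seq nat) W,
  let p := nth 0 w 2 in let Q := 2 * nth 0 w 0 * p in
  let z := nth 0 w 3 - p in let N := Q + p in
  Q + 4 = size w -> (0 < p -> 0 < Q) ->
  (forall a, blen (nth 0 w a) <= W) -> Q < W -> N * N < W ->
  exists t, exec reduction (init w) t
    (init (oct_encode (OCTInstance (conflict_graph p Q w) z)))
    /\ t <= K * W ^ 2.
Proof.
have [K1 exec1] := @block_exec 5 prelude isT.
have [K2 exec2] := @block_exec 5 body isT.
have [K3 exec3] := @block_exec 5 postlude isT.
exists (K1 + 2 * K2.+1 + K3) => w W p Q z N szw p_gt0 bw ltQW ltNW.
have W_gt0 : 0 < W by apply: leq_trans ltQW.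
have Q_neq1 : Q != 1 by rewrite /Q; lia.
have leNN : N <= N * N by case: (N) => // n; rewrite leq_pmulr.
have bQ : blen Q <= W := leq_trans (blen_leS Q) ltQW.
have bx x : x <= N * N -> blen x <= W.
  by move=> le_x; apply: leq_trans (blen_leS x) _; apply: leq_ltn_trans ltNW.
(* The loop states are known explicitly, so the length bound does not grow from one iteration to the
   next. *)
have bS x : x <= N * N -> bounded W (loop_state w p Q z x).
  move=> le_x; split=> /= [y|a]; last first.
    rewrite /loop_mem; case: ifP => _; first by rewrite blen_bool.
    by case: ifP.
  case: y => [|[|[|[|[|y]]]]] /=; rewrite ?nth_nil //; try exact: bx.
  + exact: bw.
  + exact: leq_trans (leq_blen (leq_subr _ _)) (bw 3).
have bI : bounded W (init w) by split.
have [t1 [ex1 le1]] := exec1 W (init w) (fun _ _ => erefl) bI.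
rewrite prelude_state in ex1.
(* The successor in [K2.+1 * W] lets the same bound cover the loop tests. *)
have [||x lt_x|t2 [ex2 le2]] := @countdown_exec 0
  (block_code 5 body) (K2.+1 * W) (loop_state w p Q z) (N * N).
- by [].
- by move=> j /bx le_j; apply: leq_trans le_j _; rewrite leq_pmull.
- have [t [ex le_t]] := exec2 W _ (@loop_state_zero w p Q z x.+1) (bS _ lt_x).
  rewrite body_step // in ex; exists t; split=> //.
  by rewrite mulSn (leq_trans le_t) ?leq_addl.
have [t3 [ex3 le3]] := exec3 W _ (@loop_state_zero w p Q z 0) (bS 0 isT).
rewrite postlude_state // in ex3.
- exists (t1 + (t2 + t3)); split; first exact: exec_seq ex1 (exec_seq ex2 ex3).
  have le2' : t2 <= 2 * W * (K2.+1 * W).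
    apply: leq_trans le2 _; rewrite leq_mul2r; apply/orP; right; lia.
  have leWW : W <= W ^ 2 by rewrite expnS leq_pmulr ?expn_gt0 ?W_gt0.
  have le1' : t1 <= K1 * W ^ 2 by apply: leq_trans le1 _; rewrite leq_mul.
  have le3' : t3 <= K3 * W ^ 2 by apply: leq_trans le3 _; rewrite leq_mul.
  rewrite !mulnDl addnA !leq_add //.
  by apply: leq_trans le2' _; rewrite mulnCA -!mulnA mulnn; lia.
- by move=> p0; split=> //; rewrite /Q p0 muln0.
- by move=> p_pos; have := p_gt0 p_pos; rewrite /N; move: Q_neq1; nia.
Qed.

(** * Size of the constructed instance and total running time *)

Lemma oct_bitsize (G : graph) c :
  bitsize (oct_encode (OCTInstance G c))
    = blen (Defs.order G) + blen c + Defs.order G * Defs.order G.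
Proof.
rewrite /bitsize /oct_encode big_cat /= !big_cons big_nil addn0; congr (_ + _).
set s := [seq _ | u <- _, v <- _].
have szs : size s = Defs.order G * Defs.order G.
  by rewrite size_allpairs !size_enum_ord.
rewrite -szs -sum1_size big_seq [RHS]big_seq; apply: eq_bigr => x.
by case/allpairsP=> uv [_ _ ->]; rewrite blen_bool.
Qed.

Import Order.TTheory GRing.Theory Num.Theory.

Local Open Scope ring_scope.

Theorem theorem7 (R : realType) (d : R)
  (hd : d <= 23146 / 10000)
  (hOCT : solvable_in_Ostar OCT d oct_size) :
  solvable_in_Ostar two_bMVA d zeta_p.
Proof.
have [prog [C [e oct]]] := hOCT; have [K red] := reduction_exec.
(* With [W = 5 * L ^ 2] the reduction takes at most [K * W ^ 2 = 25 * K * L ^ 4] steps, and its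
   output has at most [(5 + 5 + 4) * L ^ 2] bits. *)
exists (Seq reduction prog), ((25 * K + 1) * (C * 14 ^ e))%N, (4 + 2 * e)%N.
case=> m n p k f [/= n2 [/= red_f le_pk]]; subst n.
set I := @BMVAInstance m 2 p k f in red_f *; set w := bmva_encode I.
set L := bitsize w; pose Q := (2 * m * p)%N.
have szw : size w = (4 + Q)%N by exact: size_encode.
have leL : (4 + Q <= L)%N by rewrite -szw size_bitsize.
(* A component has a zero in some vector, so [m] is positive. *)
have p_gt0 : (0 < p -> p <= Q)%N.
  move=> p_pos; have [i _] := red_f (Ordinal p_pos).
  by have := ltn_ord i; rewrite /Q; nia.
have leN : (Q + p <= 2 * L)%N by case: (posnP p) p_gt0 => [->|_ /(_ isT)]; lia.
have leNN : ((Q + p) * (Q + p) <= 4 * L ^ 2)%N.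
  by apply: leq_trans (leq_mul leN leN) _; rewrite expnS expn1; lia.
pose W := (5 * L ^ 2)%N.
have L_gt0 : (0 < L)%N := leq_trans (isT : 0 < 4 + Q)%N leL.
have lt2LW : (2 * L < W)%N.
  by rewrite /W expnS expn1 mulnA ltn_mul2r L_gt0 /=; lia.
have ltLW : (L < W)%N by apply: leq_ltn_trans lt2LW; rewrite leq_pmull.
have bw a : (blen (nth 0%N w a) <= W)%N := leq_trans (blen_nth w a) ltLW.
have [|||||t1 [ex1 le1]] := red w W.
- by rewrite [RHS]szw addnC.
- by move=> p_pos; apply: leq_trans p_pos (p_gt0 p_pos).
- exact: bw.
- by apply: leq_ltn_trans ltLW; apply: leq_trans leL; apply: leq_addl.
- by apply: (leq_ltn_trans leNN); rewrite ltn_pmul2r ?expn_gt0 ?L_gt0.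
set J := OCTInstance _ _ in ex1; have [t2 [s [ex2 ans le2]]] := oct J Logic.I.
exists (t1 + t2)%N, s; split; first exact: exec_seq ex1 ex2.
  by apply: (iff_trans ans); split; [exact: bmva_of_oct | exact: oct_of_bmva].
have t2_gt0 : (0 < t2)%N := exec_gt0 ex2.
set D := d ^+ _.
(* The transversal size read off the cells of [w] computes to [k - p], so the two exponents agree by
   conversion. *)
have {}le2 : t2%:R <= (C * bitsize (oct_encode J) ^ e)%:R * D := le2.
(* The sign of [d] is not given, but the positive [t2] is bounded by a natural multiple of [D]. *)
have D_ge0 : 0 <= D.
  rewrite leNgt; apply/negP=> D_lt0; have : 0 < t2%:R :> R by rewrite ltr0n.
  by apply/negP; rewrite -leNgt (le_trans le2) // mulr_ge0_le0 // ltW.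
have B_le : (bitsize (oct_encode J) <= 14 * L ^ 2)%N.
  rewrite oct_bitsize.
  have b1 := leq_trans (blen_leS (Q + p)) (leq_ltn_trans leN lt2LW).
  have b2 := leq_trans (leq_blen (leq_subr p k)) (bw 3).
  by apply: leq_trans (leq_add (leq_add b1 b2) leNN) _; rewrite -!mulnDl.
have t_le : (t1 + t2 <= (25 * K + 1) * L ^ 4 * t2)%N.
  have L4 : (W ^ 2 = 25 * L ^ 4)%N by rewrite /W expnMn -expnM.
  have L4_gt0 : (0 < L ^ 4)%N by rewrite expn_gt0 L_gt0.
  have le_K : (K * W ^ 2 + 1 <= (25 * K + 1) * L ^ 4)%N.
    by rewrite L4 mulnDl mul1n (mulnC 25%N K) -mulnA leq_add2l.
  apply: leq_trans (leq_mul le_K (leqnn t2)); rewrite mulnDl mul1n leq_add2r.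
  by rewrite (leq_trans le1) // leq_pmulr.
apply: (@le_trans _ _ (((25 * K + 1) * L ^ 4)%:R * t2%:R)).
  by rewrite -natrM ler_nat.
apply: (le_trans (ler_wpM2l _ le2)); first exact: ler0n.
rewrite mulrA -natrM ler_wpM2r // ler_nat.
have Be_le : (bitsize (oct_encode J) ^ e <= 14 ^ e * L ^ (2 * e))%N.
  by rewrite expnM -expnMn; case: (e) => // e'; rewrite leq_exp2r.
apply: leq_trans (leq_mul (leqnn _) (leq_mul (leqnn C) Be_le)) _.
by rewrite expnD (mulnA C) [leqRHS]mulnACA.
Qed.
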